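(* Let $r,j,k$ be natural numbers. Then $$\sum_{t=1}^jA(j,r,t)=\frac{(-1)^{j-1}}{(j-1)!}\prod_{i=1}^{j-1}(r+i-2)=\frac{(-1)^{j-1}}{(j-1)!}(r-1)r(r+1)\cdots (r+j-3),$$ $$\sum_{t=1}^kC(k,r,t)=\frac{(-1)^{k-1}}{(k-1)!}\prod_{i=2}^{k}(r-i)=\frac{(-1)^{k-1}}{(k-1)!}(r-2)(r-3)\cdots (r-k),$$ where empty products equal $1$.
   Context: $s(j,l)$ denotes the signed Stirling numbers of the first kind, $x(x-1)\cdots(x-j+1)=\sum_{l=0}^j s(j,l)x^l$. For natural numbers $j,r$ and integers $t\ge0$, $A(j,r,t)=\sum_{l=t}^j \frac{s(j,l)}{j!}\binom{l}{t}(1-r)^{l-t}$. For natural numbers $k,r$ and $1\le t\le k$, $C(k,r,t)=\sum_{j=0}^{k-t}\binom{k-1}{j+t-1}A(j+t,r,t)$. *)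

(* Defs.v *)
From HB Require Import structures.
From mathcomp Require Import all_boot all_order all_algebra.
Set Implicit Arguments. Unset Strict Implicit. Unset Printing Implicit Defensive.
Import Order.TTheory GRing.Theory Num.Theory.
Local Open Scope ring_scope.

Definition falling_poly (j : nat) : {poly int} := \prod_(0 <= i < j) ('X - i%:R%:P).

(* s(j,l), the coefficient of x^l in x(x-1)...(x-j+1). *)
Definition stirling1 (j l : nat) : int := (falling_poly j)`_l.

Definition A (j r t : nat) : rat :=
  \sum_(t <= l < j.+1)
    (stirling1 j l)%:~R / (j`!)%:R * 'C(l, t)%:R * (1 - r%:R) ^+ (l - t).

(* Meant for 1 <= t <= k; the natural-number subtractions k - t, k - 1 and
   j + t - 1 are then exact. *)
Definition C (k r t : nat) : rat :=
  \sum_(0 <= j < (k - t).+1) 'C(k - 1, j + t - 1)%:R * A (j + t) r t.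

(* Main.v *)
(** [A j r t] is the coefficient of [x ^ t] in the binomial coefficient
    [binom (x + 1 - r) j]. Hence the sum over [t >= 1] is the value at [x = 1]
    minus the value at [x = 0], which is [binom (1 - r) (j - 1)] by Pascal's
    rule. The sum of the [C k r t] is then the Vandermonde convolution
    [\sum_m binom (k - 1) m * binom (1 - r) m = binom (k - r) (k - 1)]. *)

Require Import Defs.
From mathcomp Require Import all_boot all_order all_algebra.
From mathcomp Require Import ring.
Set Implicit Arguments. Unset Strict Implicit. Unset Printing Implicit Defensive.
Import Order.TTheory GRing.Theory Num.Theory.
Local Open Scope ring_scope.

(** The binomial coefficient [binom x n] with rational upper argument, needed because [1 - r] may be
    negative. *)
Definition gbin (x : rat) (n : nat) : rat :=
  (\prod_(0 <= i < n) (x - i%:R)) / (n`!)%:R.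

Lemma ffact_succl (x : rat) (n : nat) :
  \prod_(0 <= i < n.+1) (x + 1 - i%:R) = (x + 1) * \prod_(0 <= i < n) (x - i%:R).
Proof.
rewrite big_nat_recl // subr0; congr (_ * _); apply: eq_bigr => i _.
by rewrite -natr1; ring.
Qed.

Lemma gbin_pascal (x : rat) (n : nat) :
  gbin (x + 1) n.+1 = gbin x n + gbin x n.+1.
Proof.
rewrite /gbin ffact_succl big_nat_recr //= factS natrM -natr1.
have nfN0 : (n`!)%:R != 0 :> rat by rewrite pnatr_eq0 -lt0n fact_gt0.
have nN0 : n%:R + 1 != 0 :> rat by rewrite natr1 pnatr_eq0.
by field; rewrite nfN0 nN0.
Qed.

(* The shift [p] is what makes the induction on [n] go through. *)
Lemma gbin_vandermonde_shift (x : rat) (n p : nat) :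
  \sum_(0 <= m < n.+1) 'C(n, m)%:R * gbin x (m + p) = gbin (x + n%:R) (n + p).
Proof.
elim: n p => [|n IHn] p; first by rewrite big_nat1 bin0 mul1r addr0.
have -> : x + n.+1%:R = x + n%:R + 1 by rewrite -natr1 addrA.
(* Pascal's rule on the right produces the induction hypothesis at [p] and at [p.+1]. *)
rewrite addSn gbin_pascal -IHn -addnS -IHn.
rewrite big_nat_recl // [X in _ = X + _]big_nat_recl // !bin0 -addrA.
congr (_ + _).
under eq_bigr => m _ do rewrite binS natrD mulrDl.
rewrite big_split /= big_nat_recr //= bin_small // mul0r addr0.
by congr (_ + _); apply: eq_bigr => m _; rewrite addSnnS.
Qed.

Lemma size_falling_poly (j : nat) : size (falling_poly j) = j.+1.
Proof. by rewrite /falling_poly size_prod_XsubC size_iota subn0. Qed.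

(** Both sides evaluate [falling_poly j], mapped into the rationals, at [y]. *)
Lemma sum_stirling1 (j : nat) (y : rat) :
  \sum_(0 <= l < j.+1) (stirling1 j l)%:~R * y ^+ l =
  \prod_(0 <= i < j) (y - i%:R).
Proof.
transitivity (map_poly intr (falling_poly j)).[y].
  rewrite horner_coef size_map_inj_poly ?size_falling_poly //; last first.
    exact: intr_inj.
  by rewrite big_mkord; apply: eq_bigr => l _; rewrite coef_map.
rewrite /falling_poly rmorph_prod horner_prod; apply: eq_bigr => i _.
by rewrite rmorphB /= map_polyX map_polyC /= hornerXsubC rmorph_nat.
Qed.

(** The added terms vanish, as ['C(l, t) = 0] for [l < t]. The range of [l] is now free of [t], so
    sums over [l] and [t] can be exchanged. *)
Lemma A_widen (j r t : nat) :
  A j r t = \sum_(0 <= l < j.+1)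
    (stirling1 j l)%:~R / (j`!)%:R * ('C(l, t)%:R * (1 - r%:R) ^+ (l - t)).
Proof.
rewrite /A (big_nat_widenl _ 0) // big_mkcond; apply: eq_bigr => l _ /=.
rewrite mulrA; case: leqP => // ltlt.
by rewrite bin_small // mulr0 mul0r.
Qed.

(** Binomial theorem for [z + 1] with the term [t = 0] moved across; terms with [t > l] are zero. *)
Lemma sum_bin_pow (z : rat) (l n : nat) : (l <= n)%N ->
  \sum_(1 <= t < n.+1) 'C(l, t)%:R * z ^+ (l - t) = (z + 1) ^+ l - z ^+ l.
Proof.
move=> leln; rewrite exprDn.
under [X in _ = X - _]eq_bigr => i _ do rewrite expr1n mulr1 -mulr_natl.
rewrite -(big_mkord xpredT (fun t => 'C(l, t)%:R * z ^+ (l - t))).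
rewrite [X in _ = X - _]big_ltn // bin0 subn0 mul1r [RHS]addrC addKr.
rewrite (big_cat_nat (n := l.+1)) //= [X in _ + X = _]big_nat [X in _ + X = _]big1 ?addr0 // => t.
by case/andP=> ltlt _; rewrite bin_small // mul0r.
Qed.

Lemma sum_A (j r : nat) : (0 < j)%N ->
  \sum_(1 <= t < j.+1) A j r t = gbin (1 - r%:R) (j - 1).
Proof.
move=> j_gt0; under eq_bigr => t _ do rewrite A_widen.
rewrite exchange_big /=.
(* The values of [binom (x + 1 - r) j] at [x = 1] and [x = 0]. *)
transitivity (gbin (1 - r%:R + 1) j - gbin (1 - r%:R) j); last first.
  by case: j j_gt0 => // n _; rewrite gbin_pascal subn1 addrK.
rewrite /gbin -!sum_stirling1 -mulrBl -sumrB mulr_suml.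
apply: eq_big_nat => l /andP[_ ltlj].
by rewrite -mulr_sumr sum_bin_pow // -mulrBr mulrAC.
Qed.

Lemma sum_C (k r : nat) : (0 < k)%N ->
  \sum_(1 <= t < k.+1) C k r t = gbin (k%:R - r%:R) (k - 1).
Proof.
case: k => // n _; rewrite subn1 /=.
(* Here [m = j + t]; the terms with [m < t] come for free, since [A m r t] is then an empty sum. *)
have CE t : (0 < t < n.+2)%N -> C n.+1 r t =
    \sum_(1 <= m < n.+2) 'C(n, m - 1)%:R * A m r t.
  case/andP=> t_gt0 lttn; rewrite (big_cat_nat (n := t)) //=; last exact: ltnW.
  rewrite [X in _ = X + _]big_nat [X in _ = X + _]big1 ?add0r => [|m /andP[_ ltmt]]; last first.
    by rewrite /A big_geq // mulr0.
  by rewrite -{2}[t]add0n big_addn subSn // /C subn1.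
rewrite (eq_big_nat _ _ CE) exchange_big /=.
(* For fixed [m] the terms with [t > m] vanish, which leaves the sum of [sum_A]. *)
transitivity (\sum_(1 <= m < n.+2) 'C(n, m - 1)%:R * gbin (1 - r%:R) (m - 1)).
  apply: eq_big_nat => m /andP[m_gt0 ltmn]; rewrite -mulr_sumr -sum_A //.
  congr (_ * _); rewrite (big_cat_nat (n := m.+1)) //=.
  rewrite [X in _ + X = _]big_nat [X in _ + X = _]big1 ?addr0 // => t /andP[ltmt _].
  by rewrite /A big_geq.
rewrite big_add1 /=.
have -> : n.+1%:R - r%:R = 1 - r%:R + n%:R :> rat by rewrite -natr1; ring.
rewrite -[X in gbin (_ + _) X]addn0 -gbin_vandermonde_shift.
by apply: eq_bigr => m _; rewrite subn1 addn0.
Qed.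

(** Negating each factor makes [r] positive in it when [x] is [1 - r] or [k - r]. *)
Lemma gbinN (x : rat) (n : nat) :
  gbin x n = (-1) ^+ n / (n`!)%:R * \prod_(0 <= i < n) (i%:R - x).
Proof.
rewrite mulrAC /gbin; congr (_ / _).
have <- : \prod_(0 <= i < n) (-1) = (-1) ^+ n :> rat.
  by rewrite big_const_nat subn0 iter_mulr_1.
by rewrite -big_split /=; apply: eq_bigr => i _; ring.
Qed.

Theorem theorem2p8 (r j k : nat) (hr : (0 < r)%N) (hj : (0 < j)%N) (hk : (0 < k)%N) :
  \sum_(1 <= t < j.+1) A j r t =
    (-1) ^+ (j - 1) / ((j - 1)`!)%:R * \prod_(1 <= i < j) (r%:R + i%:R - 2)
  /\
  \sum_(1 <= t < k.+1) C k r t =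
    (-1) ^+ (k - 1) / ((k - 1)`!)%:R * \prod_(2 <= i < k.+1) (r%:R - i%:R).
Proof.
split.
  rewrite sum_A // gbinN; congr (_ * _); rewrite big_add1 subn1.
  by apply: eq_bigr => i _; rewrite -natr1; ring.
rewrite sum_C // gbinN; congr (_ * _).
(* The two products list the same factors in opposite order. *)
rewrite big_add1 big_add1 /= subn1 big_nat_rev /=.
apply: eq_big_nat => i /andP[_ lti].
have -> : k%:R = k.-1%:R + 1 :> rat by rewrite natr1 prednK.
by rewrite add0n natrB // -!natr1; ring.
Qed.
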